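(* Let $(G,H,\sigma)$ be a reduced $1$-dimensional Hecke triple with Schlichting completion $(G_\sigma,H_\sigma,\sigma)$. If $\sigma\neq1$, then the trivial representation of $G_\sigma$ is not unitary $(H_\sigma,\sigma)$-smooth, and $p_\sigma$ is not full in $C^*(G_\sigma)$.
   Context: A Hecke pair $(G,H)$ is a group $G$ with a subgroup $H$ such that $[H:H\cap xHx^{-1}]<\infty$ for all $x\in G$. The Hecke topology from $(G,H)$ is the group topology on $G$ with $\{xHx^{-1}\mid x\in G\}$ as neighbourhood subbase at $e$; the pair is reduced if $\bigcap_{x\in G}xHx^{-1}=\{e\}$. The Schlichting completion of a reduced Hecke pair consists of the completion of $G$ in the Hecke topology (locally compact, totally disconnected) and the closure of the subgroup in it (compact open). A $1$-dimensional Hecke triple $(G,H,\sigma)$ is a Hecke pair $(G,H)$ with a unitary character $\sigma:H\to\mathbb{T}$ with finite range; $K=\ker\sigma$; it is reduced if the Hecke pair $(G,K)$ is. Its Schlichting completion $(G_\sigma,H_\sigma,\sigma)$: $(G_\sigma,K_\sigma)$ is the Schlichting completion of $(G,K)$, $H_\sigma$ is the closure of $H$ in $G_\sigma$ (compact open), and $\sigma$ denotes also the unique continuous extension to $H_\sigma$. With Haar measure on $G_\sigma$ normalised so that $H_\sigma$ has measure $1$, $p_\sigma=\chi_{H_\sigma}\sigma\in C_c(G_\sigma)\subset C^*(G_\sigma)$ is a projection. It is full if $\overline{C^*(G_\sigma)p_\sigma C^*(G_\sigma)}=C^*(G_\sigma)$ (closed linear span). A (continuous) unitary representation $\pi$ of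 $G_\sigma$ on a Hilbert space $V$ is unitary $(H_\sigma,\sigma)$-smooth if $\overline{\operatorname{span}}(\pi(G_\sigma)V_{H_\sigma,\pi})=V$, where $V_{H_\sigma,\pi}=\{\xi\in V\mid\pi(h)\xi=\sigma(h)\xi\ \forall h\in H_\sigma\}$. The trivial representation is the one-dimensional one. *)

(* Defs.v *)
From HB Require Import structures.
From mathcomp Require Import all_boot all_order all_algebra.
From mathcomp Require Import complex.
From mathcomp Require Import all_classical all_reals all_analysis.

Set Implicit Arguments.
Unset Strict Implicit.
Unset Printing Implicit Defensive.

Import Order.TTheory GRing.Theory Num.Theory.
Import numFieldNormedType.Exports.

Local Open Scope classical_set_scope.
Local Open Scope ring_scope.
Local Open Scope complex_scope.

Section hecke.
Variable G : groupType.
Implicit Types (H K : set G) (x : G).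

Definition subgroup H := H 1%g /\ forall x y, H x -> H y -> H (x / y)%g.

Definition lcoset x H : set G := [set (x * h)%g | h in H].

Definition conj_subgroup x H : set G := [set (x * h * x^-1)%g | h in H].

Definition finite_index H K := finite_set [set lcoset h K | h in H].

Definition hecke_pair H :=
  subgroup H /\ forall x, finite_index H (H `&` conj_subgroup x H).

Definition reduced_pair H := \bigcap_x conj_subgroup x H = [set 1%g].

Definition hecke_basic_nbhs H (s : seq G) : set G :=
  [set g | forall y, y \in s -> conj_subgroup y H g].

(* Open sets of the group topology on G having the conjugates of H as a
   neighbourhood subbase at 1. *)
Definition hecke_open H (U : set G) :=
  forall x, U x -> exists s : seq G, lcoset x (hecke_basic_nbhs H s) `<=` U.

(* A character of H is given by a function on G; only its values on H matter. *)
Definition unitary_character (R : realType) H (sigma : G -> R[i]) :=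
  (forall h k, H h -> H k -> sigma (h * k)%g = sigma h * sigma k) /\
  (forall h, H h -> `|sigma h| = 1).

Definition char_ker (R : realType) H (sigma : G -> R[i]) : set G :=
  [set h | H h /\ sigma h = 1].

Definition hecke_triple (R : realType) H (sigma : G -> R[i]) :=
  [/\ hecke_pair H, unitary_character H sigma & finite_set (sigma @` H)].

Definition reduced_triple (R : realType) H (sigma : G -> R[i]) :=
  reduced_pair (char_ker H sigma).

End hecke.

(* The base point plays no role: it is only there because measurable types
   are pointed. *)
HB.structure Definition PreTopologicalGroup :=
  {L of PointedTopological L & Group L}.

HB.mixin Record isTopologicalGroup L & PreTopologicalGroup L := {
  mulg_continuous : continuous (fun xy : L * L => (xy.1 * xy.2)%g);
  invg_continuous : continuous (fun x : L => x^-1%g)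
}.

#[short(type="topologicalGroupType")]
HB.structure Definition TopologicalGroup :=
  {L of isTopologicalGroup L & PreTopologicalGroup L}.

(* Cauchy filters for the two-sided uniform structure. *)
Definition group_cauchy (L : topologicalGroupType) (F : set_system L) :=
  forall U, nbhs (1%g : L) U -> exists2 A, F A &
    forall x y, A x -> A y -> U (x^-1 * y)%g /\ U (x * y^-1)%g.

Definition complete_group (L : topologicalGroupType) :=
  forall F : set_system L, ProperFilter F -> group_cauchy F ->
    exists x : L, F --> x.

(* iota exhibits L as the completion of G in the Hecke topology of (G, H). *)
Record hecke_completion (G : groupType) (H : set G)
    (L : topologicalGroupType) (iota : {multiplicative G -> L}) : Prop := {
  hecke_completion_hausdorff : hausdorff_space L;
  hecke_completion_complete : complete_group L;
  hecke_completion_inj : injective iota;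
  hecke_completion_embedding : forall U : set G,
    hecke_open H U <-> exists2 V : set L, open V & U = iota @^-1` V;
  hecke_completion_dense : closure (range iota) = setT
}.

Definition completed_subgroup (G : groupType) (H : set G)
    (L : topologicalGroupType) (iota : {multiplicative G -> L}) : set L :=
  closure (iota @` H).

Record schlichting_completion (R : realType) (G : groupType) (H : set G)
    (sigma : G -> R[i]) (L : topologicalGroupType)
    (iota : {multiplicative G -> L}) (sigma' : L -> R[i]^o) : Prop := {
  schlichting_hecke : hecke_completion (char_ker H sigma) iota;
  schlichting_cont : {within completed_subgroup H iota, continuous sigma'};
  schlichting_ext : forall h, H h -> sigma' (iota h) = sigma h
}.

(* Norms take values in R[i]. *)
HB.mixin Record isHilbert (R : realType) V & CompleteNormedModule R[i] V := {
  dotp : V -> V -> R[i];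
  dotp_linear : forall (a : R[i]) (u v w : V),
    dotp (a *: u + v) w = a * dotp u w + dotp v w;
  dotpC : forall u v : V, dotp v u = (dotp u v)^*;
  dotp_norm : forall u : V, dotp u u = `|u| ^+ 2
}.

#[short(type="hilbertType")]
HB.structure Definition Hilbert (R : realType) :=
  {V of isHilbert R V & CompleteNormedModule R[i] V}.

Definition lin_span (R : realType) (V : lmodType R[i]) (S : set V) : set V :=
  [set v | exists (n : nat) (c : 'I_n -> R[i]) (s : 'I_n -> V),
     (forall i, S (s i)) /\ v = \sum_(i < n) c i *: s i].

Record unitary_rep (R : realType) (L : topologicalGroupType)
    (V : hilbertType R) := UnitaryRep {
  rep :> L -> V -> V;
  rep_linear : forall x a u v, rep x (a *: u + v) = a *: rep x u + rep x v;
  rep1 : forall v, rep 1%g v = v;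
  repM : forall x y v, rep (x * y)%g v = rep x (rep y v);
  rep_unitary : forall x u v, dotp (rep x u) (rep x v) = dotp u v;
  rep_continuous : forall v, continuous (fun x => rep x v)
}.

Definition isotypic (R : realType) (L : topologicalGroupType) (H : set L)
    (sigma : L -> R[i]) (V : hilbertType R) (rho : unitary_rep L V) : set V :=
  [set xi | forall h, H h -> rho h xi = sigma h *: xi].

Definition unitary_smooth (R : realType) (L : topologicalGroupType) (H : set L)
    (sigma : L -> R[i]) (V : hilbertType R) (rho : unitary_rep L V) :=
  closure (lin_span [set rho x xi | x in setT & xi in isotypic H sigma rho])
  = setT.

(* The complex numbers as a Hilbert space over themselves; an alias of R[i]^o,
   whose completeness instance is keyed on real scalars. *)
Definition Cline (R : realType) : Type := R[i]^o.

HB.instance Definition _ (R : realType) := NormedModule.copy (Cline R) R[i]^o.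

Lemma complex_complete (R : realType) (F : set_system R[i]^o) :
  ProperFilter F -> cauchy F -> cvg F.
Proof.
move=> FF /cauchy_ballP cF.
have part (p : R[i]^o -> R) :
    (forall x y : R[i]^o, `|p x - p y|%:C <= `|x - y|) -> cvg (p @ F).
  move=> hp; apply: R_complete; apply/cauchy_ballP => e e0.
  have e0' : 0 < e%:C :> R[i] by rewrite ltcR.
  have [[A B] /= [FA FB] AB] := cF _ e0'.
  exists (p @` A, p @` B) => /=.
    by split; [apply: filterS FA|apply: filterS FB] => x ?; exists x.
  move=> [_ _] /= [[x Ax <-] [y By <-]].
  have := AB (x, y) (conj Ax By).
  rewrite /= -!ball_normE /= => xy.
  by rewrite -ltcR; apply: le_lt_trans xy; exact: hp.
have /cvg_ex[a Fa] : cvg ((@complex.Re R : R[i]^o -> R) @ F).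
  by apply: part => x y; rewrite -raddfB; exact: normc_ge_Re.
have /cvg_ex[b Fb] : cvg ((@complex.Im R : R[i]^o -> R) @ F).
  apply: part => x y; rewrite -raddfB /= -normrN -ReiNIm.
  apply: le_trans (normc_ge_Re _) _.
  by rewrite normrM [`|'i%C|]normc_def /= expr0n expr1n add0r sqrtr1 mulr1.
apply/cvg_ex; exists (a +i* b : R[i]^o).
apply/cvgrPdist_lt => e e0.
have eR : (complex.Re e)%:C = e by apply: RRe_real; exact: gtr0_real.
have e2 : 0 < complex.Re e / 2.
  by rewrite divr_gt0// -ltcR eR.
move/cvgrPdist_lt : Fa => /(_ _ e2) Fa; move/cvgrPdist_lt : Fb => /(_ _ e2) Fb.
near=> z.
have za : `|a - complex.Re z| < complex.Re e / 2 by near: z; exact: Fa.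
have zb : `|b - complex.Im z| < complex.Re e / 2 by near: z; exact: Fb.
rewrite -eR normc_def ltcR.
move: za zb; case: (z) => u v /= za zb.
apply: (@le_lt_trans _ _ (`|a - u| + `|b - v|)); last first.
  by rewrite [ltRHS](splitr (complex.Re e)) ltrD.
rewrite -(@ler_pXn2r _ 2)// ?nnegrE ?sqrtr_ge0 ?addr_ge0//.
rewrite sqr_sqrtr ?addr_ge0 ?sqr_ge0// [leRHS]sqrrD.
rewrite !real_normK ?num_real//.
by rewrite [leRHS]addrAC lerDl mulrn_wge0// mulr_ge0.
Unshelve. all: by end_near. Qed.

HB.instance Definition _ (R : realType) :=
  Uniform_isComplete.Build (Cline R) (@complex_complete R).

Section Cline_hilbert.
Variable R : realType.

Let dot (u v : Cline R) : R[i] := (u : R[i]) * (v : R[i])^*.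

Let dot_linear (a : R[i]) (u v w : Cline R) :
  dot (a *: u + v) w = a * dot u w + dot v w.
Proof. by rewrite /dot mulrDl -mulrA. Qed.

Let dotC u v : dot v u = (dot u v)^*.
Proof. by rewrite /dot rmorphM /= conjcK mulrC. Qed.

Let dot_norm u : dot u u = `|u| ^+ 2.
Proof. by rewrite /dot -sqr_normc. Qed.

HB.instance Definition _ :=
  isHilbert.Build R (Cline R) dot_linear dotC dot_norm.

End Cline_hilbert.

Section trivial_rep.
Variables (R : realType) (L : topologicalGroupType).

Let triv (_ : L) (v : Cline R) : Cline R := v.

Let triv_linear x (a : R[i]) u v :
  triv x (a *: u + v) = a *: triv x u + triv x v.
Proof. by []. Qed.

Let triv1 v : triv 1%g v = v. Proof. by []. Qed.

Let trivM x y v : triv (x * y)%g v = triv x (triv y v). Proof. by []. Qed.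

Let triv_unitary x u v : dotp (triv x u) (triv x v) = dotp u v.
Proof. by []. Qed.

Let triv_continuous v : continuous (fun x => triv x v).
Proof. by move=> x; exact: cvg_cst. Qed.

Definition trivial_rep : unitary_rep L (Cline R) :=
  UnitaryRep triv_linear triv1 trivM triv_unitary triv_continuous.

End trivial_rep.

(* Not necessarily unital. *)
HB.mixin Record isCstarAlgebra (R : realType) A
    & CompleteNormedModule R[i] A := {
  amul : A -> A -> A;
  astar : A -> A;
  amulA : forall a b c : A, amul a (amul b c) = amul (amul a b) c;
  amul_linearl : forall (z : R[i]) (a b c : A),
    amul (z *: a + b) c = z *: amul a c + amul b c;
  amul_linearr : forall (z : R[i]) (a b c : A),
    amul a (z *: b + c) = z *: amul a b + amul a c;
  astarK : forall a : A, astar (astar a) = a;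
  astar_antilinear : forall (z : R[i]) (a b : A),
    astar (z *: a + b) = z^* *: astar a + astar b;
  astarM : forall a b : A, astar (amul a b) = amul (astar b) (astar a);
  amul_norm : forall a b : A, `|amul a b| <= `|a| * `|b|;
  cstar_norm : forall a : A, `|amul (astar a) a| = `|a| ^+ 2
}.

#[short(type="cstarAlgebraType")]
HB.structure Definition CstarAlgebra (R : realType) :=
  {A of isCstarAlgebra R A & CompleteNormedModule R[i] A}.

Definition borelGroup (L : topologicalGroupType) :=
  g_sigma_algebraType (@open L).

Section group_cstar_algebra.
Variables (R : realType) (L : topologicalGroupType).
Variable mu : {measure set (borelGroup L) -> \bar R}.
Implicit Types (f g : L -> R[i]) (x y : L).

(* Left Haar measures, as nonzero left-invariant Radon measures. *)
Record haar_measure : Prop := {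
  haar_left_invariant : forall x (A : set (borelGroup L)), measurable A ->
    mu [set (x * y)%g | y in (A : set L)] = mu A;
  haar_neq0 : mu setT <> 0%E;
  haar_compact : forall K : set L, compact K -> (mu K < +oo)%E;
  haar_outer_regular : forall A : set (borelGroup L), measurable A ->
    mu A = ereal_inf [set mu U | U in [set U : set L | open U /\ A `<=` U]];
  haar_inner_regular : forall U : set L, open U ->
    mu U = ereal_sup [set mu K | K in [set K : set L | compact K /\ K `<=` U]]
}.

(* The modular function, with the convention mu (A x) = Delta(x) mu(A). *)
Definition modular x : R :=
  get [set c : R | 0 < c /\ forall A : set (borelGroup L), measurable A ->
    mu [set (y * x)%g | y in (A : set L)] = (c%:E * mu A)%E].

Definition Cintegral f : R[i] :=
  (\int[mu]_x complex.Re (f x)) +i* (\int[mu]_x complex.Im (f x)).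

Definition Cc : set (L -> R[i]) :=
  [set f | continuous (f : L -> R[i]^o) /\
     exists2 K : set L, compact K & forall x, ~ K x -> f x = 0].

Definition convolution f g : L -> R[i] :=
  fun x => Cintegral (fun y => f y * g (y^-1 * x)%g).

Definition involution f : L -> R[i] :=
  fun x => (modular x^-1%g)%:C * (f x^-1%g)^*.

(* T is the operator \int f(x) rho(x) dx, the integral being weak. *)
Definition integrated_form (V : hilbertType R) (rho : unitary_rep L V) f
    (T : V -> V) :=
  forall xi eta : V,
    dotp (T xi) eta = Cintegral (fun x => f x * dotp (rho x xi) eta).

Definition operator_norm (V : hilbertType R) (T : V -> V) : \bar R :=
  ereal_sup [set (complex.Re `|T xi|)%:E | xi in [set xi : V | `|xi| <= 1]].

Definition universal_norm f : \bar R :=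
  ereal_sup [set r | exists (V : hilbertType R) (rho : unitary_rep L V)
                            (T : V -> V),
    integrated_form rho f T /\ r = operator_norm T].

(* j exhibits A as C*(L), the completion of the *-algebra C_c(L) in its
   universal norm; j is irrelevant outside C_c(L). *)
Record group_cstar (A : cstarAlgebraType R) (j : (L -> R[i]) -> A) : Prop := {
  group_cstar_linear : forall (z : R[i]) f g, Cc f -> Cc g ->
    j (fun x => z * f x + g x) = z *: j f + j g;
  group_cstar_mul : forall f g, Cc f -> Cc g ->
    j (convolution f g) = amul (j f) (j g);
  group_cstar_star : forall f, Cc f -> j (involution f) = astar (j f);
  group_cstar_norm : forall f, Cc f ->
    (complex.Re `|j f|)%:E = universal_norm f;
  group_cstar_dense : closure (j @` Cc) = setT
}.

End group_cstar_algebra.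

Definition char_projection (R : realType) (L : topologicalGroupType)
    (H : set L) (sigma : L -> R[i]) : L -> R[i] :=
  fun x => if x \in H then sigma x else 0.

Definition full (R : realType) (A : cstarAlgebraType R) (p : A) :=
  closure (lin_span [set amul (amul a p) b | a in setT & b in setT]) = setT.

(* Main.v *)
(* Let I be the Haar integral, i.e. the trivial representation on C_c(G_sigma).
   Any k = p * g satisfies k(h x) = sigma(h) k(x) for h in H_sigma, so
   translating by an h with sigma(h) <> 1 gives I(k) = 0.  Splitting f along
   the left cosets of H_sigma turns f * k into a finite combination of left
   translates of k; hence I(f * p * g) = 0 without appealing to Fubini.  Since
   |I(f)| <= |j(f)|, the closure of the image of the kernel of I is a closed
   subspace containing A p A but not the image of the indicator of H_sigma. *)
Require Import Defs.
From mathcomp Require Import all_boot all_order all_algebra.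
From mathcomp Require Import complex.
From mathcomp Require Import all_classical all_reals all_analysis.
Set Implicit Arguments.
Unset Strict Implicit.
Unset Printing Implicit Defensive.
Import Order.TTheory GRing.Theory Num.Theory.
Import numFieldNormedType.Exports.

Local Open Scope classical_set_scope.
Local Open Scope ring_scope.
Local Open Scope complex_scope.

(** * Elementary facts on subgroups *)

Section subgroup.
Variable G : groupType.
Implicit Types (x y : G) (A : set G).

Lemma subgroupV A x : subgroup A -> A x -> A x^-1%g.
Proof. by move=> [A1 Adiv] Ax; rewrite -[x^-1%g]mul1g; exact: Adiv. Qed.

Lemma subgroupM A x y : subgroup A -> A x -> A y -> A (x * y)%g.
Proof.
move=> sA Ax Ay; rewrite -[y]invgK; apply: (proj2 sA) => //.
exact: subgroupV.
Qed.

Lemma subgroupMl A x y : subgroup A -> A x -> A (x * y)%g <-> A y.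
Proof.
move=> sA Ax; split; last exact: subgroupM.
by move=> /(subgroupM sA (subgroupV sA Ax)); rewrite mulKg.
Qed.

End subgroup.

(** * Topological groups: translations, closures of subgroups, open subgroups *)

Section topological_group.
Variable L : topologicalGroupType.
Implicit Types (x y : L) (A B : set L).

Lemma lmulg_continuous x : continuous (fun y => (x * y)%g).
Proof.
move=> y; apply: (@continuous2_cvg _ _ _ _ _ _ _ _ (fun a b : L => (a * b)%g)).
- exact: (mulg_continuous (x, y)).
- exact: cvg_cst.
- exact: cvg_id.
Qed.

Lemma rmulg_continuous x : continuous (fun y => (y * x)%g).
Proof.
move=> y; apply: (@continuous2_cvg _ _ _ _ _ _ _ _ (fun a b : L => (a * b)%g)).
- exact: (mulg_continuous (y, x)).
- exact: cvg_id.
- exact: cvg_cst.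
Qed.

Lemma divg_continuous : continuous (fun xy : L * L => (xy.1 / xy.2)%g).
Proof.
move=> [x y]; apply: (@continuous2_cvg _ _ _ _ _ _ _ _
  (fun a b : L => (a * b)%g)).
- exact: (mulg_continuous (x, y^-1%g)).
- exact: cvg_fst.
- by apply: continuous_comp; [exact: cvg_snd|exact: invg_continuous].
Qed.

Lemma open_lmulg x A : open A -> open [set y | A (x * y)%g].
Proof. by move=> oA; apply: open_comp => // y _; exact: lmulg_continuous. Qed.

Lemma subgroup_closure A : subgroup A -> subgroup (closure A).
Proof.
move=> [A1 Adiv]; split; first exact: subset_closure.
move=> x y Ax Ay U nU.
have [[V W]/= [Vx Wy] VWU] := @divg_continuous (x, y) U nU.
have [a [Aa Va]] := Ax _ Vx; have [b [Ab Wb]] := Ay _ Wy.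
by exists (a / b)%g; split; [exact: Adiv|exact: (VWU (a, b))].
Qed.

(** Left translation by [x / y], an element of [A], carries [y] to [x] and preserves membership in
    [A], so one interior point makes every point interior. *)
Lemma open_subgroup A x : subgroup A -> nbhs x A -> open A.
Proof.
move=> sA Ax; rewrite openE => y Ay; rewrite /interior/=.
have Axx : A x by exact: nbhs_singleton.
have : nbhs y [set z | A ((x / y) * z)%g].
  by apply: lmulg_continuous; rewrite mulgVK.
apply: filterS => z /=; apply: (iffLR (subgroupMl _ _ _)) => //.
exact: (proj2 sA).
Qed.

End topological_group.
(** Any neighbourhoods of [f x] and [g x] share a value [f a = g a] with [a] in [A] near [x].
    Continuity is asked at [x] alone, because the extended character is known to be continuous only
    on the open subgroup. *)
Lemma closure_continuous_eq (T U : topologicalType) (A : set T) (f g : T -> U)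
    (x : T) : hausdorff_space U -> closure A x ->
  {for x, continuous f} -> {for x, continuous g} ->
  (forall a, A a -> f a = g a) -> f x = g x.
Proof.
move=> hU Ax fx gx fg; apply: hU => V W fV gW.
have nV : nbhs x (f @^-1` V) by exact: fx.
have nW : nbhs x (g @^-1` W) by exact: gx.
have [a [Aa [Va Wa]]] := Ax _ (filterI nV nW).
by exists (f a); split => //; rewrite fg.
Qed.

Lemma multiplicative_group1 (G G' : groupType) (f : {multiplicative G -> G'}) :
  f 1%g = 1%g.
Proof. by apply: (@mulgI _ (f 1%g)); rewrite -gmulfM !mulg1. Qed.

Lemma multiplicative_groupF (G G' : groupType) (f : {multiplicative G -> G'}) :
  {morph f : x y / (x / y)%g}.
Proof. by move=> x y; apply: (@mulIg _ (f y)); rewrite -gmulfM !mulgVK. Qed.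

(** * The closure of [H] in the completion and the extended character *)

Section completion.
Variables (R : realType) (G : groupType) (H : set G) (sigma : G -> R[i]).
Variables (L : topologicalGroupType) (iota : {multiplicative G -> L}).
Hypothesis sH : subgroup H.

Lemma completed_subgroup_group : subgroup (completed_subgroup H iota).
Proof.
apply: subgroup_closure; split=> [|_ _ [x Hx <-] [y Hy <-]].
  by exists 1%g; [exact: (proj1 sH)|rewrite multiplicative_group1].
by exists (x / y)%g; [exact: (proj2 sH)|rewrite multiplicative_groupF].
Qed.

(** [H] is open in the Hecke topology of the smaller [K], hence is the preimage of an open [V]. By
    density of the image of [iota], points of [V] are limits of points [iota g] in [V], and such [g]
    lie in [H]; so the closure contains the neighbourhood [V] of 1. *)
Lemma completed_subgroup_open (K : set G) : K `<=` H ->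
  hecke_completion K iota -> open (completed_subgroup H iota).
Proof.
move=> KH comp.
have : hecke_open K H.
  (* The conjugate of [K] by 1 is [K] itself, and [x K] stays in [H]. *)
  move=> x Hx; exists [:: 1%g] => _ [h Kh <-].
  have [k Kk <-] := Kh 1%g (mem_head _ _).
  by rewrite mul1g invg1 mulg1; apply: subgroupM => //; exact: KH.
move=> /(hecke_completion_embedding comp)[V oV HV].
have VH : V `<=` completed_subgroup H iota.
  move=> v Vv U Uv.
  have : closure (range iota) v by rewrite (hecke_completion_dense comp).
  have nV := open_nbhs_nbhs (conj oV Vv).
  move=> /(_ _ (filterI Uv nV))[_ [[g _ <-] [Ug Vg]]].
  by exists (iota g); split => //; exists g => //; rewrite HV.
apply: (@open_subgroup _ _ 1%g); first exact: completed_subgroup_group.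
have V1 : V 1%g by have := proj1 sH; rewrite HV /= multiplicative_group1.
exact: (filterS VH (open_nbhs_nbhs (conj oV V1))).
Qed.

Variable sigma' : L -> R[i]^o.
Hypothesis charH : unitary_character H sigma.
Hypothesis comp : schlichting_completion H sigma iota sigma'.

Let Hb := completed_subgroup H iota.

Lemma schlichting_open : open Hb.
Proof.
by apply: completed_subgroup_open (schlichting_hecke comp) => h [].
Qed.

Lemma schlichting_continuous : {in Hb, continuous sigma'}.
Proof.
rewrite -continuous_open_subspace; first exact: schlichting_cont comp.
exact: schlichting_open.
Qed.

Lemma schlichting_character x y : Hb x -> Hb y ->
  sigma' (x * y)%g = sigma' x * sigma' y.
Proof.
move=> Hx Hy.
have cs z : Hb z -> {for z, continuous sigma'}.
  by move=> Hz; apply: schlichting_continuous; rewrite inE.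
have cl : closure ((iota @` H) `*` (iota @` H)) (x, y).
  move=> U [[V W]/= [Vx Wy] VWU].
  have [a [Ha Va]] := Hx _ Vx; have [b [Hb' Wb]] := Hy _ Wy.
  by exists (a, b); split => //; exact: VWU.
apply: (@closure_continuous_eq _ R[i]^o _ (fun z => sigma' (z.1 * z.2)%g)
  (fun z => sigma' z.1 * sigma' z.2) _ _ cl).
- exact: norm_hausdorff.
- apply: (@continuous_comp _ _ _ (fun z : L * L => (z.1 * z.2)%g) sigma').
    exact: mulg_continuous.
  by apply: cs; exact: (subgroupM completed_subgroup_group Hx Hy).
- have c1 : {for (x, y), continuous (fun z : L * L => sigma' z.1)}.
    by apply: (@continuous_comp _ _ _ fst sigma'); [exact: cvg_fst|exact: cs].
  have c2 : {for (x, y), continuous (fun z : L * L => sigma' z.2)}.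
    by apply: (@continuous_comp _ _ _ snd sigma'); [exact: cvg_snd|exact: cs].
  exact: (@cvgM _ _ _ _ _ _ _ _ c1 c2).
- move=> [_ _] [/= [a Ha <-] [b Hb' <-]].
  rewrite -gmulfM !(schlichting_ext comp)//; first exact: (proj1 charH).
  exact: subgroupM.
Qed.

End completion.

(** * Continuity of real and imaginary parts *)

Section complex_parts.
Variables (R : realType).

Lemma continuous_complex_lipschitz (p : R[i]^o -> R) :
  (forall x y, `|p x - p y|%:C <= `|x - y|) -> continuous p.
Proof.
move=> pL z; apply/(@cvgrPdist_lt _ _ _ _ (nbhs_filter (z : R[i]^o))) => e e0.
have eC0 : 0 < e%:C :> R[i] by rewrite ltcR.
have /(@cvgrPdist_lt _ R[i]^o)/(_ _ eC0) :
    (fun w : R[i]^o => w) w @[w --> z] --> z.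
  exact: cvg_id.
by apply: filterS => w zw; rewrite -ltcR; exact: le_lt_trans (pL _ _) zw.
Qed.

Lemma Re_continuous : continuous (@complex.Re R : R[i]^o -> R).
Proof.
apply: continuous_complex_lipschitz => x y; rewrite -raddfB.
exact: normc_ge_Re.
Qed.

Lemma Im_continuous : continuous (@complex.Im R : R[i]^o -> R).
Proof.
(* Up to sign, the imaginary part is the real part after multiplication by ['i], which has norm
   1. *)
apply: continuous_complex_lipschitz => x y; rewrite -raddfB /= -normrN -ReiNIm.
apply: le_trans (normc_ge_Re _) _.
by rewrite normrM [`|'i%C|]normc_def /= expr0n expr1n add0r sqrtr1 mulr1.
Qed.

End complex_parts.

(** * The Haar integral: integrability, linearity and left invariance *)

Section haar_integral.
Variables (R : realType) (L : topologicalGroupType).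
Variable mu : {measure set (borelGroup L) -> \bar R}.
Hypotheses (hL : hausdorff_space L) (haar : haar_measure mu).
Implicit Types (f g : L -> R[i]) (r : L -> R) (x y : L).

Lemma open_measurable_borel (U : set L) : open U ->
  measurable (U : set (borelGroup L)).
Proof. exact: sub_sigma_algebra. Qed.

Lemma closed_measurable_borel (U : set L) : closed U ->
  measurable (U : set (borelGroup L)).
Proof.
move=> cU; rewrite -[U]setCK; apply: measurableC.
by apply: open_measurable_borel; exact: closed_openC.
Qed.

Lemma compact_measurable_borel (K : set L) : compact K ->
  measurable (K : set (borelGroup L)).
Proof. by move=> cK; apply: closed_measurable_borel; exact: compact_closed. Qed.

Lemma continuous_borel_real r : continuous r ->
  measurable_fun setT (r : borelGroup L -> R).
Proof.
move=> /continuousP cr.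
apply: (measurability _ (measurable_realfun.RGenOpens.measurableE R)).
move=> _ [_ [a [b ->]] <-]; rewrite setTI.
by apply: open_measurable_borel; apply: cr; exact: interval_open.
Qed.

Lemma continuous_borel_group (phi : L -> L) : continuous phi ->
  measurable_fun setT (phi : borelGroup L -> borelGroup L).
Proof.
move=> /continuousP cphi.
apply: (@measurability _ _ (borelGroup L) (borelGroup L) setT phi
  (@open L)) => //.
move=> _ [U oU <-]; rewrite setTI.
by apply: open_measurable_borel; exact: cphi.
Qed.

(** A continuous function is bounded on the compact [K], whose Haar measure is finite. *)
Lemma compact_support_integrable r (K : set L) : continuous r -> compact K ->
  (forall x, ~ K x -> r x = 0) ->
  mu.-integrable setT (EFin \o (r : borelGroup L -> R)).
Proof.
move=> cr cK r0; have mK := compact_measurable_borel cK.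
rewrite (_ : _ \o _ = (EFin \o r) \_ K); last first.
  apply/funext => x /=; rewrite patchE; case: ifPn => // /negP.
  by rewrite inE => /r0 ->.
apply/(integrable_mkcond _ mK).
apply: (measurable_bounded_integrable mK).
- exact: (haar_compact haar).
- by apply: measurable_funTS; exact: continuous_borel_real.
- have : compact (r @` K).
    by apply: continuous_compact => //; exact: continuous_subspaceT.
  move=> /(@compact_bounded _ R^o)[M [Mr rM]].
  by exists M; split => // N /rM bN x Kx; apply: bN; exists x.
Qed.

(** For [p] the real or the imaginary part; [p 0 = 0] keeps the support inside the same compact
    set. *)
Lemma Cc_comp_integrable (p : R[i]^o -> R) f :
  continuous p -> p 0 = 0 -> Cc f ->
  mu.-integrable setT (EFin \o (p \o f : borelGroup L -> R)).
Proof.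
move=> cp p0 [cf [K cK fK]]; apply: (compact_support_integrable _ cK).
  by move=> x; exact: (@continuous_comp L R[i]^o R f p x (cf x) (cp (f x))).
by move=> x /fK /= ->.
Qed.

Lemma Cintegral_linear (z : R[i]) f g : Cc f -> Cc g ->
  Cintegral mu (fun x => z * f x + g x) = z * Cintegral mu f + Cintegral mu g.
Proof.
move=> cf cg; case: z => a b.
have If := Cc_comp_integrable (@Re_continuous R) erefl cf.
have Jf := Cc_comp_integrable (@Im_continuous R) erefl cf.
have Ig := Cc_comp_integrable (@Re_continuous R) erefl cg.
have Jg := Cc_comp_integrable (@Im_continuous R) erefl cg.
have mT : measurable (setT : set (borelGroup L)) by [].
have IZ (c : R) (r : L -> R) :
  mu.-integrable setT (EFin \o (r : borelGroup L -> R)) ->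
  mu.-integrable setT (EFin \o ((fun x => c * r x) : borelGroup L -> R)).
  by move=> Ir; exact: (integrableZl mT c Ir).
rewrite /Cintegral.
have -> : (\int[mu]_x complex.Re ((a +i* b) * f x + g x))%R =
   (\int[mu]_x (a * complex.Re (f x) - b * complex.Im (f x)
     + complex.Re (g x)))%R.
  by apply: eq_Rintegral => x _; case: (f x) (g x) => [u v] [u' v'].
have -> : (\int[mu]_x complex.Im ((a +i* b) * f x + g x))%R =
   (\int[mu]_x (a * complex.Im (f x) + b * complex.Re (f x)
     + complex.Im (g x)))%R.
  by apply: eq_Rintegral => x _; case: (f x) (g x) => [u v] [u' v'].
have IaB := integrableB mT (IZ a _ If) (IZ b _ Jf).
have IaD := integrableD mT (IZ a _ Jf) (IZ b _ If).
rewrite (RintegralD mT IaB Ig) (RintegralD mT IaD Jg).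
rewrite (RintegralB mT (IZ a _ If) (IZ b _ Jf)).
rewrite (RintegralD mT (IZ a _ Jf) (IZ b _ If)).
by rewrite !(RintegralZl _ mT If) !(RintegralZl _ mT Jf).
Qed.

Lemma Cc_lmulg x f : Cc f -> Cc (fun y => f (x * y)%g).
Proof.
move=> [cf [K cK fK]]; split.
  move=> y; apply: (@continuous_comp L L R[i]^o (fun y => (x * y)%g) f).
    exact: lmulg_continuous.
  exact: cf.
exists [set (x^-1 * y)%g | y in K].
  apply: continuous_compact => //; apply: continuous_subspaceT.
  exact: lmulg_continuous.
move=> y nKy; apply: fK => Kxy; apply: nKy.
by exists (x * y)%g => //; rewrite mulKg.
Qed.

(** Left invariance says that [mu] equals its own pushforward under [y |-> x y]; the rest is change
    of variables. *)
Lemma Rintegral_lmulg x r :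
  mu.-integrable setT (EFin \o (r : borelGroup L -> R)) ->
  mu.-integrable setT (EFin \o ((fun y => r (x * y)%g) : borelGroup L -> R)) ->
  (\int[mu]_y r (x * y)%g)%R = (\int[mu]_y r y)%R.
Proof.
move=> ir irx; rewrite /Rintegral; congr fine.
pose phi : borelGroup L -> borelGroup L := fun y => (x * y)%g.
have mphi : measurable_fun setT phi.
  by apply: continuous_borel_group; exact: lmulg_continuous.
have phiE (A : set (borelGroup L)) : measurable A ->
    pushforward mu phi A = mu A.
  (* The preimage of [A] under left translation by [x] is the translate of [A] by [x^-1]. *)
  move=> mA; rewrite /pushforward -(haar_left_invariant haar x^-1%g mA).
  congr (mu _); apply/seteqP; split=> [y Ay|_ [y Ay <-]].
    by exists (x * y)%g => //; rewrite mulKg.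
  by rewrite /phi /preimage/= mulVKg.
have mT : measurable (setT : set (borelGroup L)) by [].
have -> : (\int[mu]_y (r y)%:E = \int[pushforward mu phi]_y (r y)%:E)%E.
  apply/esym/(eq_measure_integral mu) => A mA _; exact: phiE.
rewrite (@integral_pushforward _ _ _ _ _ phi mphi mu setT (EFin \o r))//.
by have /integrableP[] := ir.
Qed.

Lemma Cintegral_lmulg x f : Cc f ->
  Cintegral mu (fun y => f (x * y)%g) = Cintegral mu f.
Proof.
move=> cf; have cfx := Cc_lmulg x cf; rewrite /Cintegral.
have re0 := @Re_continuous R; have im0 := @Im_continuous R.
rewrite (Rintegral_lmulg (Cc_comp_integrable re0 erefl cf)
  (Cc_comp_integrable re0 erefl cfx)).
by rewrite (Rintegral_lmulg (Cc_comp_integrable im0 erefl cf)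
  (Cc_comp_integrable im0 erefl cfx)).
Qed.

End haar_integral.

(** * Closure properties of the space of compactly supported continuous functions *)

Section compactly_supported.
Variables (R : realType) (L : topologicalGroupType).
Implicit Types (f g : L -> R[i]) (x y : L).

Lemma Cc_linear (z : R[i]) f g : Cc f -> Cc g -> Cc (fun x => z * f x + g x).
Proof.
move=> [cf [K cK fK]] [cg [K' cK' gK']]; split.
  move=> x; apply: (@cvgD R[i]^o R[i]^o); last exact: cg.
  by apply: (@cvgM R[i]^o); [exact: cvg_cst|exact: cf].
exists (K `|` K'); first exact: compactU.
move=> x /not_orP[Kx K'x]; rewrite fK// gK'//.
by rewrite mulr0 addr0.
Qed.

Lemma Cc0 : Cc (fun _ : L => 0 : R[i]).
Proof.
split; first by move=> x; exact: cvg_cst.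
by exists set0; first exact: compact0.
Qed.

Lemma Cc_scale (z : R[i]) f : Cc f -> Cc (fun x => z * f x).
Proof.
move=> cf; rewrite (_ : (fun _ => _) = (fun x => z * f x + 0)).
  exact: Cc_linear cf Cc0.
by apply/funext => x; rewrite addr0.
Qed.

Lemma Cc_mul f (u : L -> R[i]^o) : Cc f -> continuous u ->
  Cc (fun x => f x * u x).
Proof.
move=> [cf [K cK fK]] cu; split.
  by move=> x; apply: (@cvgM R[i]^o); [exact: cf|exact: cu].
by exists K => // x Kx; rewrite fK// mul0r.
Qed.

End compactly_supported.

(** * Convolution, and compactness of open subgroups of measure 1 *)

Section convolution.
Variables (R : realType) (L : topologicalGroupType).
Variable mu : {measure set (borelGroup L) -> \bar R}.
Hypotheses (hL : hausdorff_space L) (haar : haar_measure mu).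
Implicit Types (f g k : L -> R[i]) (x y : L).

Local Notation I := (Cintegral mu).

Lemma Cintegral0 : I (fun=> 0) = 0.
Proof.
have c0 := @Cc0 R L.
(* With both functions zero, linearity for the scalar -1 reads [I 0 = - I 0 + I 0]. *)
have := Cintegral_linear hL haar (-1) c0 c0.
by under [X in I X]eq_fun do rewrite mulr0 addr0; rewrite mulN1r addNr.
Qed.

Lemma CintegralZ (z : R[i]) f : Cc f -> I (fun x => z * f x) = z * I f.
Proof.
move=> cf; have := Cintegral_linear hL haar z cf (@Cc0 R L).
by under [X in I X]eq_fun do rewrite addr0; rewrite Cintegral0 addr0.
Qed.

Lemma convolution_integrand f k x : Cc f -> continuous (k : L -> R[i]^o) ->
  Cc (fun y => f y * k (y^-1 * x)%g).
Proof.
move=> cf ck; apply: (@Cc_mul _ _ f (fun y => k (y^-1 * x)%g) cf) => y.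
apply: (@continuous_comp L L R[i]^o (fun y => (y^-1 * x)%g) k); last exact: ck.
apply: (@continuous_comp L L L (fun y => y^-1%g) (fun y => (y * x)%g)).
  exact: invg_continuous.
exact: rmulg_continuous.
Qed.

Lemma convolution_linear (z : R[i]) f g k : Cc f -> Cc g ->
  continuous (k : L -> R[i]^o) ->
  convolution mu (fun x => z * f x + g x) k =
  (fun x => z * convolution mu f k x + convolution mu g k x).
Proof.
move=> cf cg ck; apply/funext => x; rewrite /convolution.
rewrite -(Cintegral_linear hL haar); [|exact: convolution_integrand..].
by congr Cintegral; apply/funext => y; rewrite mulrDl mulrA.
Qed.

(** If the integrand is nonzero at some [y], then [y] is in [A] and [y^-1 x] is in [B], so their
    product [x] is in [A B]. *)
Lemma convolution_support f k (A B : set L) : (forall x, ~ A x -> f x = 0) ->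
  (forall x, ~ B x -> k x = 0) ->
  forall x, ~ [set (y.1 * y.2)%g | y in A `*` B] x -> convolution mu f k x = 0.
Proof.
move=> fA kB x nx; rewrite /convolution -Cintegral0; congr Cintegral.
apply/funext => y; have [Ay|/fA ->] := pselect (A y); last by rewrite mul0r.
rewrite kB ?mulr0// => By; apply: nx; exists (y, y^-1 * x)%g => //=.
by rewrite mulVKg.
Qed.

Lemma compact_mulg (A B : set L) : compact A -> compact B ->
  compact [set (y.1 * y.2)%g | y in A `*` B].
Proof.
move=> cA cB; apply: continuous_compact; last exact: compact_setX.
by apply: continuous_subspaceT; exact: mulg_continuous.
Qed.

(* By inner regularity A contains a compact K of measure > 1/2; each translate
   h K with h in A must then meet K, so A = K K^-1. *)
Lemma measure1_subgroup_compact (A : set L) : subgroup A -> open A ->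
  mu A = 1%E -> compact A.
Proof.
move=> sA oA A1.
have : (2^-1%:E < mu A)%E by rewrite A1 lte_fin invf_lt1// ltr1n.
rewrite (haar_inner_regular haar oA) => /ereal_sup_gt[_ [K [cK KA] <-] K2].
have mA := open_measurable_borel oA.
have mK := compact_measurable_borel hL cK.
suff -> : A = [set (y.1 / y.2)%g | y in K `*` K].
  apply: continuous_compact; last exact: compact_setX.
  by apply: continuous_subspaceT; exact: divg_continuous.
apply/seteqP; split=> [h Ah|_ [[y z] [/KA Ay /KA Az] <-]]; last first.
  exact: (proj2 sA).
pose hK := [set (h * y)%g | y in K].
have chK : compact hK.
  apply: continuous_compact => //; apply: continuous_subspaceT.
  exact: lmulg_continuous.
have mhK := compact_measurable_borel hL chK.
have muhK : mu hK = mu K by exact: haar_left_invariant.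
apply: contrapT => nh.
have dis : K `&` hK = set0.
  apply/seteqP; split=> // z [Kz [y Ky hy]]; apply: nh.
  by exists (z, y)%g => //=; rewrite -hy mulgK.
have : (mu (K `|` hK) <= mu A)%E.
  apply: le_measure; rewrite ?inE//; first exact: measurableU.
  by rewrite subUset; split=> // _ [y /KA Ay <-]; exact: subgroupM.
have -> : mu (K `|` hK) = (mu K + mu K)%E by rewrite -{2}muhK; exact: measureU.
rewrite A1; apply/negP; rewrite -ltNge.
apply: le_lt_trans (lteD K2 K2).
by rewrite -EFinD lee_fin [leLHS](splitr 1) div1r.
Qed.

End convolution.

(** * Continuity and compact support of the projection attached to a character *)

Section char_projection.
Variables (R : realType) (L : topologicalGroupType).
Variables (Hb : set L) (s : L -> R[i]^o).
Hypotheses (gH : subgroup Hb) (oH : open Hb) (cs : {in Hb, continuous s}).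

Local Notation p := (char_projection Hb s).

Lemma char_projectionE x : Hb x -> p x = s x.
Proof. by move=> Hx; rewrite /char_projection mem_set. Qed.

Lemma char_projection_out x : ~ Hb x -> p x = 0.
Proof. by move=> Hx; rewrite /char_projection memNset. Qed.

(** An open subgroup is also closed: a point [x] outside [Hb] has the coset [Hb x], disjoint from
    [Hb], as a neighbourhood, and there the function is 0. *)
Lemma char_projection_continuous : continuous (p : L -> R[i]^o).
Proof.
move=> x; have [Hx|nHx] := pselect (Hb x).
  have : s @ x --> (p x : R[i]^o).
    by rewrite char_projectionE//; apply: cs; rewrite inE.
  apply: cvg_trans; apply: near_eq_cvg.
  have : nbhs x Hb by exact: open_nbhs_nbhs.
  by apply: filterS => y Hy; rewrite char_projectionE.
have : (fun=> 0 : R[i]^o) @ x --> (p x : R[i]^o).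
  by rewrite char_projection_out//; exact: cvg_cst.
apply: cvg_trans; apply: near_eq_cvg.
have : nbhs x [set y | Hb ((y * x^-1)%g)].
  apply: (@rmulg_continuous L x^-1%g x); rewrite mulgV.
  by apply: open_nbhs_nbhs; split => //; exact: (proj1 gH).
apply: filterS => y /= Hyx; rewrite char_projection_out// => Hy; apply: nHx.
have := subgroupM gH (subgroupV gH Hyx) Hy.
by rewrite invgM invgK mulgVK.
Qed.

Lemma char_projection_Cc : compact Hb -> Cc p.
Proof.
move=> cH; split; first exact: char_projection_continuous.
by exists Hb => // x; exact: char_projection_out.
Qed.

End char_projection.

(** * Functions transforming by the character under left translation by [Hb] *)

Section open_subgroup_character.
Variables (R : realType) (L : topologicalGroupType).
Variables (Hb : set L) (s : L -> R[i]^o).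
Hypotheses (gH : subgroup Hb) (oH : open Hb) (cs : {in Hb, continuous s}).
Hypothesis sM : forall x y, Hb x -> Hb y -> s (x * y)%g = s x * s y.

Local Notation p := (char_projection Hb s).

Lemma char_projectionM h x : Hb h -> p (h * x)%g = s h * p x.
Proof.
move=> Hh; have [Hx|nHx] := pselect (Hb x).
  by rewrite !char_projectionE// ?sM//; exact: subgroupM.
rewrite !char_projection_out ?mulr0//.
by apply: contra_not nHx => /subgroupMl; apply.
Qed.

Definition equivariant (k : L -> R[i]) :=
  forall h x, Hb h -> k (h * x)%g = s h * k x.

(* Near x, k agrees with y |-> s(y x^-1) k(x). *)
Lemma equivariant_continuous k : equivariant k -> continuous (k : L -> R[i]^o).
Proof.
move=> ek x.
have : (fun y => p (y * x^-1)%g * k x : R[i]^o) @ x --> (k x : R[i]^o).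
  have px : p (x * x^-1)%g * k x = k x.
    rewrite mulgV char_projectionE; last exact: (proj1 gH).
    by rewrite -ek ?mul1g//; exact: (proj1 gH).
  rewrite -[in X in _ --> X]px.
  apply: (@cvgM R[i]^o); last exact: cvg_cst.
  apply: (@continuous_comp L L R[i]^o (fun y => (y * x^-1)%g) p).
    exact: rmulg_continuous.
  exact: char_projection_continuous.
apply: cvg_trans; apply: near_eq_cvg.
have : nbhs x [set y | Hb ((y * x^-1)%g)].
  apply: (@rmulg_continuous L x^-1%g x); rewrite mulgV.
  by apply: open_nbhs_nbhs; split => //; exact: (proj1 gH).
apply: filterS => y /= Hyx.
by rewrite char_projectionE// -ek// mulgVK.
Qed.

Variable mu : {measure set (borelGroup L) -> \bar R}.
Hypotheses (hL : hausdorff_space L) (haar : haar_measure mu) (cH : compact Hb).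

Local Notation I := (Cintegral mu).

(** Substitute [h y] for [y] in the integral: [p] contributes the factor [s h], while the argument
    [(h y)^-1 (h x)] of [g] becomes [y^-1 x]. *)
Lemma convolution_equivariant g : Cc g -> equivariant (convolution mu p g).
Proof.
move=> [cg _] h x Hh; rewrite /convolution.
rewrite -(Cintegral_lmulg hL haar h); last first.
  exact: convolution_integrand (char_projection_Cc gH oH cs cH) cg.
rewrite -(CintegralZ hL haar); last first.
  exact: convolution_integrand (char_projection_Cc gH oH cs cH) cg.
congr Cintegral; apply/funext => y.
by rewrite char_projectionM// invgM -mulgA mulKg mulrA.
Qed.

(** Continuity follows from equivariance under an open subgroup; the support lies in the compact
    product [Hb K]. *)
Lemma convolution_equivariant_Cc g : Cc g -> Cc (convolution mu p g).
Proof.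
move=> cg; split; first exact/equivariant_continuous/convolution_equivariant.
have [_ [K cK gK]] := cg.
exists [set (y.1 * y.2)%g | y in Hb `*` K]; first exact: compact_mulg.
exact: convolution_support (@char_projection_out _ _ Hb s) gK.
Qed.

(** Translating by [h] multiplies the integral by [s h] and, by left invariance, leaves it
    unchanged. *)
Lemma equivariant_integral0 k h : Hb h -> s h <> 1 -> equivariant k -> Cc k ->
  I k = 0.
Proof.
move=> Hh sh1 ek ck; have := Cintegral_lmulg hL haar h ck.
under [X in I X]eq_fun do rewrite ek//.
rewrite (CintegralZ hL haar)// => /eqP.
rewrite -subr_eq0 -[X in _ - X]mul1r -mulrBl mulf_eq0 => /orP[|/eqP//].
by rewrite subr_eq0 => /eqP.
Qed.

(** For [y] in [x0 Hb], write [y^-1 x] as [(y^-1 x0) (x0^-1 x)]: equivariance pulls out the scalar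
    [s (y^-1 x0)], independent of [x]. The constant [c] is the integral of [f] against this scalar,
    with [p] in place of [s] so that the integrand is continuous. *)
Lemma convolution_coset f k x0 : (forall x, ~ Hb (x0^-1 * x)%g -> f x = 0) ->
  Cc f -> equivariant k ->
  exists c, convolution mu f k = (fun x => c * k (x0^-1 * x)%g).
Proof.
move=> f0 cf ek; exists (I (fun y => f y * p (y^-1 * x0)%g)).
apply/funext => x; rewrite /convolution mulrC -(CintegralZ hL haar); last first.
  exact: convolution_integrand cf (char_projection_continuous gH oH cs).
congr Cintegral; apply/funext => y.
have [Hy|/f0 ->] := pselect (Hb (x0^-1 * y)%g); last by rewrite !mul0r mulr0.
have Hy' : Hb (y^-1 * x0)%g.
  by have := subgroupV gH Hy; rewrite invgM invgK.
by rewrite char_projectionE// [RHS]mulrC -mulrA -ek// -mulgA mulVKg.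
Qed.

(** Induction on a finite list of representatives whose cosets cover the support of [f]. The part of
    [f] on one coset convolves with [k] to a multiple of a translate of [k], which has integral
    0. *)
Lemma convolution_equivariant_integral0 f k : Cc f -> equivariant k -> Cc k ->
  I k = 0 -> Cc (convolution mu f k) /\ I (convolution mu f k) = 0.
Proof.
move=> cf ek ck Ik0.
have [A fA] : exists A : seq L, forall x,
    (forall a, a \in A -> ~ Hb (a^-1 * x)%g) -> f x = 0.
  have [_ [K cK fK]] := cf; move: cK; rewrite compact_cover => cK.
  (* The open cosets [a Hb], with [a] in [K], cover the compact [K]; [D] indexes a finite
     subcover. *)
  have [|x Kx|D _ KD] := cK L K (fun a => [set x | Hb (a^-1 * x)%g]).
  - by move=> a _; exact: open_lmulg.
  - by exists x => //=; rewrite mulVg; exact: (proj1 gH).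
  exists (finmap.enum_fset D) => x xD; apply: fK => /KD[a /= aD]; exact: xD.
elim: A f cf fA => [|a A IH] f cf fA.
  have -> : convolution mu f k = (fun=> 0).
    apply/funext => x; rewrite /convolution -(Cintegral0 hL haar).
    by congr Cintegral; apply/funext => y; rewrite fA// mul0r.
  by rewrite (Cintegral0 hL haar); split => //; exact: Cc0.
(* [u] is the indicator of the coset [a Hb]; [f1] is the part of [f] on it and [f2] the remainder,
   which vanishes off the cosets left in the list. *)
pose u x : R[i]^o := char_projection Hb (fun=> 1 : R[i]^o) (a^-1 * x)%g.
have cu : continuous u.
  move=> x.
  apply: (@continuous_comp L L R[i]^o (fun x => a^-1 * x)%g
    (char_projection Hb (fun=> 1 : R[i]^o))); first exact: lmulg_continuous.
  by apply: char_projection_continuous => // z _; exact: cvg_cst.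
pose f1 x := f x * u x; pose f2 x := -1 * f1 x + f x.
have cf1 : Cc f1 by exact: Cc_mul.
have cf2 : Cc f2 by exact: Cc_linear.
have -> : f = (fun x => 1 * f1 x + f2 x).
  by apply/funext => x; rewrite /f2 mul1r mulN1r addNKr.
rewrite (convolution_linear hL haar 1 cf1 cf2 (proj1 ck)).
have [|c1 I1] := IH f2 cf2.
  move=> x xA; rewrite /f2 /f1 /u /char_projection; case: ifPn => [_|/negP].
    by rewrite mulr1 mulN1r addNr.
  rewrite inE => nx; rewrite mulr0 mulr0 add0r; apply: fA => b.
  by rewrite inE => /predU1P[->//|]; exact: xA.
have [|c ->] := @convolution_coset f1 k a _ cf1 ek.
  by move=> x nx; rewrite /f1 /u /char_projection memNset// mulr0.
have cka : Cc (fun x => c * k (a^-1 * x)%g) by exact/Cc_scale/Cc_lmulg.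
split; first exact: Cc_linear.
rewrite (Cintegral_linear hL haar)// I1 addr0 mul1r.
rewrite (CintegralZ hL haar); last exact: Cc_lmulg.
by rewrite (Cintegral_lmulg hL haar)// Ik0 mulr0.
Qed.

End open_subgroup_character.

(** * Closures and continuity in normed spaces *)

Section closed_subspace.
Variables (K : numFieldType) (V : normedModType K).
Implicit Types S : set V.

Lemma closure_linear_closed S (a : K) (u v : V) :
  (forall (a : K) u v, S u -> S v -> S (a *: u + v)) ->
  closure S u -> closure S v -> closure S (a *: u + v).
Proof.
move=> Slin Su Sv U nU.
have cadd : {for (u, v), continuous (fun w : V * V => a *: w.1 + w.2)}.
  by apply: cvgD; [apply: cvgZr; exact: cvg_fst|exact: cvg_snd].
have [[A B]/= [Au Bv] ABU] := cadd U nU.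
have [x [Sx Ax]] := Su _ Au; have [y [Sy By]] := Sv _ Bv.
by exists (a *: x + y); split; [exact: Slin|exact: (ABU (x, y))].
Qed.

End closed_subspace.

Lemma closure_image_sub (T U : topologicalType) (A : set T) (B : set U)
    (f : T -> U) : continuous f -> (forall x, A x -> closure B (f x)) ->
  forall x, closure A x -> closure B (f x).
Proof.
move=> cf AB x Ax W nW.
(* [W] need not be open; each point of [V] has [W] as a neighbourhood, so a point of [closure B] in
   [V] suffices. *)
have [V nV VW] : exists2 V, nbhs (f x) V & V `<=` [set y | nbhs y W].
  by exists (W°%classic); [exact: nbhs_interior|].
have nV' : nbhs x (f @^-1` V) by exact: cf.
have [y [Ay Vy]] := Ax _ nV'; exact: (AB _ Ay _ (VW _ Vy)).
Qed.

Lemma lipschitz_continuous (K : numFieldType) (V W : normedModType K)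
    (f : V -> W) (c : K) : 0 <= c ->
  (forall x y, `|f x - f y| <= `|x - y| * c) -> continuous f.
Proof.
move=> c0 fc x; apply/cvgrPdist_lt => e e0.
(* Dividing by [c + 1] covers the case [c = 0]. *)
have c1 : 0 < c + 1 by rewrite ltr_wpDl.
have ec : 0 < e / (c + 1) by rewrite divr_gt0.
have : \forall y \near x, `|x - y| < e / (c + 1).
  by apply: cvgr_dist_lt => //; exact: cvg_id.
apply: filterS => y xy; apply: le_lt_trans (fc x y) _.
rewrite ltr_pdivlMr// in xy; apply: le_lt_trans xy.
by rewrite ler_wpM2l// lerDl.
Qed.

(** * Separate continuity of the product in a C*-algebra *)

Section algebra_multiplication.
Variables (R : realType) (A : cstarAlgebraType R).
Implicit Types a b : A.

Lemma amulBl a b c : amul (a - b) c = amul a c - amul b c :> A.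
Proof.
by rewrite addrC -scaleN1r amul_linearl scaleN1r addrC.
Qed.

Lemma amulBr a b c : amul a (b - c) = amul a b - amul a c :> A.
Proof.
by rewrite addrC -scaleN1r amul_linearr scaleN1r addrC.
Qed.

Lemma amulr_continuous b : continuous (fun a : A => amul a b).
Proof.
apply: (@lipschitz_continuous _ _ _ _ `|b|) => // x y.
by rewrite -amulBl; exact: amul_norm.
Qed.

Lemma amull_continuous a : continuous (fun b : A => amul a b).
Proof.
apply: (@lipschitz_continuous _ _ _ _ `|a|) => // x y.
by rewrite -amulBr mulrC; exact: amul_norm.
Qed.

End algebra_multiplication.

(** * The trivial representation on the group C*-algebra and the failure of fullness *)

Section trivial_character.
Variables (R : realType) (L : topologicalGroupType).
Variable mu : {measure set (borelGroup L) -> \bar R}.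
Hypotheses (hL : hausdorff_space L) (haar : haar_measure mu).
Variables (A : cstarAlgebraType R) (j : (L -> R[i]) -> A).
Hypothesis cstar : group_cstar mu j.

Local Notation I := (Cintegral mu).

(** The trivial representation integrates [f] to multiplication by [I f], so it contributes at least
    [|I f|] to the supremum defining the universal norm. *)
Lemma Cintegral_le_norm f : Cc f -> `|I f| <= `|j f|.
Proof.
move=> cf.
pose T (v : Cline R) : Cline R := I f *: v.
have Tf : integrated_form mu (trivial_rep R L) f T.
  move=> xi eta.
  have -> : dotp (T xi) eta = I f * dotp xi eta by rewrite /dotp/= /T mulrA.
  rewrite mulrC -(CintegralZ hL haar)//; congr Cintegral; apply/funext => x.
  by rewrite mulrC.
have : ((complex.Re `|I f|)%:E <= (complex.Re `|j f|)%:E)%E.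
  rewrite (group_cstar_norm cstar cf).
  apply: (@le_trans _ _ (operator_norm T)); apply: ereal_sup_ubound.
    (* The unit vector 1 witnesses the lower bound for the operator norm. *)
    exists (1 : R[i]); first by rewrite /= normr1.
    by rewrite -[in RHS](mulr1 (I f)).
  by exists (Cline R), (trivial_rep R L), T.
rewrite lee_fin => Ij; rewrite -[leLHS]RRe_real ?normr_real//.
by rewrite -[leRHS]RRe_real ?normr_real// lecR.
Qed.

(** Its closure stands in for the kernel of the trivial character of [A], so the Haar integral need
    not be extended from functions to [A]. *)
Definition kernel_image : set A := j @` [set f | Cc f /\ I f = 0].

Lemma kernel_image_linear (z : R[i]) u v :
  kernel_image u -> kernel_image v -> kernel_image (z *: u + v).
Proof.
move=> [f [cf If] <-] [g [cg Ig] <-]; exists (fun x => z * f x + g x).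
  split; first exact: Cc_linear.
  by rewrite (Cintegral_linear hL haar)// If Ig mulr0 addr0.
exact: group_cstar_linear cstar _ _ _ cf cg.
Qed.

Lemma Cintegral_indic (B : set L) : measurable (B : set (borelGroup L)) ->
  I (char_projection B (fun=> 1)) = (fine (mu B))%:C.
Proof.
move=> mB; rewrite /Cintegral.
have -> : (\int[mu]_x complex.Re (char_projection B (fun=> 1) x) =
    \int[mu]_x \1_B x)%R.
  apply: eq_Rintegral => x _; rewrite /char_projection indicE.
  by case: ifPn.
have -> : (\int[mu]_x complex.Im (char_projection B (fun=> 1) x) =
    \int[mu]_x (cst 0 x))%R.
  by apply: eq_Rintegral => x _; rewrite /char_projection; case: ifPn.
by rewrite Rintegral_cst// mul0r /Rintegral integral_indic// setIT.
Qed.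

(** [U] supplies a function of integral 1, whose image stays at distance at least 1 from
    [kernel_image], while [conv0] puts the products [f * p * g] into the kernel of [I]. *)
Lemma not_full (p : L -> R[i]) (U : set L) : Cc p ->
  subgroup U -> open U -> compact U -> mu U = 1%E ->
  (forall f g, Cc f -> Cc g ->
     let k := convolution mu p g in
     [/\ Cc k, Cc (convolution mu f k) & I (convolution mu f k) = 0]) ->
  ~ full (j p).
Proof.
move=> cp sU oU cU U1 conv0.
pose N := closure kernel_image.
have Nlin (z : R[i]) u v : N u -> N v -> N (z *: u + v).
  by apply: closure_linear_closed => *; exact: kernel_image_linear.
have N0 : N 0.
  apply: subset_closure; exists (fun=> 0).
    by split; [exact: Cc0|exact: Cintegral0].
  (* Linearity of [j] with scalar -1 on zero functions gives [j 0 = 0]. *)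
  have := group_cstar_linear cstar (-1) (@Cc0 R L) (@Cc0 R L).
  rewrite scaleN1r addNr => <-; congr j.
  by apply/funext => x; rewrite mulr0 addr0.
have Nfg f g : Cc f -> Cc g -> N (amul (amul (j f) (j p)) (j g)).
  move=> cf cg; have [ck cfk I0] := conv0 f g cf cg.
  apply: subset_closure; exists (convolution mu f (convolution mu p g)) => //.
  by rewrite !(group_cstar_mul cstar)// amulA.
have NNE : closure N `<=` N by exact: closed_closure.
(* Density of the image of [j] replaces first [j g], then [j f], by arbitrary elements of [A]. *)
have Nfb f b : Cc f -> N (amul (amul (j f) (j p)) b).
  move=> cf; apply: (@closure_image_sub _ _ (j @` @Cc R L) kernel_image
    (fun b => amul (amul (j f) (j p)) b)).
  - exact: amull_continuous.
  - by move=> _ [g cg <-]; exact: Nfg.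
  - by rewrite (group_cstar_dense cstar).
have Nab a b : N (amul (amul a (j p)) b).
  apply: (@closure_image_sub _ _ (j @` @Cc R L) kernel_image
    (fun a => amul (amul a (j p)) b)).
  - move=> x.
    apply: (@continuous_comp _ _ _ (fun a => amul a (j p)) (fun a => amul a b)).
      exact: amulr_continuous.
    exact: amulr_continuous.
  - by move=> _ [f cf <-]; exact: Nfb.
  - by rewrite (group_cstar_dense cstar).
move=> jp_full.
pose u : L -> R[i] := char_projection U (fun=> 1).
have cu : Cc u by apply: char_projection_Cc => // z _; exact: cvg_cst.
have Iu : I u = 1.
  by rewrite Cintegral_indic ?U1//; exact: open_measurable_borel.
have : N (j u).
  apply: NNE.
  have : closure (lin_span [set amul (amul a (j p)) b |
      a in setT & b in setT]) (j u).
    by rewrite [closure _]jp_full.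
  apply: closure_subset => _ [n [c [s [sS ->]]]].
  apply: (big_ind N) => // [x y Nx Ny|i _].
    by rewrite -[x]scale1r; exact: Nlin.
  rewrite -[_ *: _]addr0; apply: Nlin => //.
  by have [a _ [b _ <-]] := sS i.
(* Choose [f] in the kernel of [I] with [j f] within distance 1 of [j u]; then
   [1 = |I (u - f)| <= |j u - j f| < 1]. *)
move=> /(_ _ (nbhsx_ballx (j u) 1 ltr01))[_ [[f [cf If] <-]]].
rewrite -ball_normE /= => uf1.
have := Cintegral_le_norm (Cc_linear (-1) cf cu).
rewrite (Cintegral_linear hL haar)// If mulr0 add0r Iu normr1.
rewrite (group_cstar_linear cstar)// scaleN1r addrC.
by move=> /le_lt_trans/(_ uf1); rewrite ltxx.
Qed.

End trivial_character.

(** * Non-smoothness and non-fullness from one [h] with [sigma h <> 1] *)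

Theorem proposition5p4 (R : realType) (G : groupType) (H : set G)
    (sigma : G -> R[i]) (Gs : topologicalGroupType)
    (iota : {multiplicative G -> Gs}) (sigma' : Gs -> R[i]^o)
    (Htriple : hecke_triple H sigma) (Hreduced : reduced_triple H sigma)
    (Hcompletion : schlichting_completion H sigma iota sigma')
    (Hsigma : exists2 h, H h & sigma h <> 1) :
  ~ unitary_smooth (completed_subgroup H iota) sigma' (trivial_rep R Gs) /\
  (forall mu : {measure set (borelGroup Gs) -> \bar R},
     haar_measure mu -> mu (completed_subgroup H iota) = 1%E ->
     forall (A : cstarAlgebraType R) (j : (Gs -> R[i]) -> A),
       group_cstar mu j ->
       ~ full (j (char_projection (completed_subgroup H iota) sigma'))).
Proof.
have [[sH _] cH _] := Htriple.
have hL := hecke_completion_hausdorff (schlichting_hecke Hcompletion).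
have [h Hh sh1] := Hsigma.
set Hb := completed_subgroup H iota.
have sHb : subgroup Hb by exact: completed_subgroup_group.
have oHb : open Hb by exact: (schlichting_open sH Hcompletion).
have cs : {in Hb, continuous sigma'}.
  exact: (schlichting_continuous sH Hcompletion).
have sM x y : Hb x -> Hb y -> sigma' (x * y)%g = sigma' x * sigma' y.
  exact: (schlichting_character sH cH Hcompletion).
have Hbh : Hb (iota h) by apply: subset_closure; exists h.
have s'h1 : sigma' (iota h) <> 1 by rewrite (schlichting_ext Hcompletion).
split.
  rewrite /unitary_smooth => smooth.
  (* An isotypic vector satisfies [xi = sigma' (iota h) *: xi] with a scalar other than 1. *)
  have iso0 xi : isotypic Hb sigma' (trivial_rep R Gs) xi -> xi = 0.
    move=> /(_ _ Hbh) /= xiE; have [//|xi0] := eqVneq xi 0; case: s'h1.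
    by apply: (@mulIf R[i] xi xi0); rewrite mul1r; exact: esym xiE.
  (* The span of the isotypic vectors is then zero, and so is its closure, yet smoothness would put
     1 in it. *)
  have : [set (0 : Cline R)] 1.
    have -> : [set (0 : Cline R)] = closure [set 0].
      apply/closure_id/accessible_closed_set1.
      exact/hausdorff_accessible/norm_hausdorff.
    apply: (@closure_subset _ (lin_span [set trivial_rep R Gs x xi | x in setT &
      xi in isotypic Hb sigma' (trivial_rep R Gs)])); last by rewrite smooth.
    move=> _ [n [c [s [sS ->]]]] /=; apply: big1 => i _.
    by have [x _ [xi /iso0 -> <-]] := sS i; rewrite /= scaler0.
  by move=> /= /eqP; rewrite oner_eq0.
move=> mu haar mu1 A j cstar.
(* Compactness of [Hb] is read off from its normalised Haar measure. *)
have cHb : compact Hb by exact: (measure1_subgroup_compact hL haar).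
have cp := char_projection_Cc sHb oHb cs cHb.
apply: (not_full hL haar cstar cp sHb oHb cHb mu1) => f g cf cg k.
have ck : Cc k.
  exact: (convolution_equivariant_Cc sHb oHb cs sM hL haar cHb cg).
have ek := convolution_equivariant sHb oHb cs sM hL haar cHb cg.
have Ik := equivariant_integral0 hL haar Hbh s'h1 ek ck.
have [cfk Ifk] :=
  convolution_equivariant_integral0 sHb oHb cs hL haar cf ek ck Ik.
by split.
Qed.
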